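(* For each $t=0,1,\dots,T-1$ define $$E_t=(R_t+\widehat B_t^\top\widehat P_{t+1}\widehat B_t)\widehat K_t-\widehat B_t^\top\widehat P_{t+1}\widehat A_t,\qquad F_t=\widehat B_t^\top\widehat P_{t+1}\widehat D_t\bar w_t+\widehat B_t^\top\widehat r_{t+1}.$$ Then the gradient of the cost with respect to $\widehat K_t$ is $$\nabla_tC(\widehat K)=2E_t\Sigma_t-2F_t\mu_t .$$
   Context: Let $m,n,k,T\ge1$ be integers, $A_t\in\mathbb R^{m\times m}$, $B_t\in\mathbb R^{m\times n}$, $D_t\in\mathbb R^{m\times k}$, $R_t\in\mathbb R^{n\times n}$ symmetric positive definite ($0\le t\le T-1$), and $Q_t\in\mathbb R^{m\times m}$ symmetric positive definite ($0\le t\le T$). Set $$\widehat A_t=\begin{bmatrix}A_t&0\\0&1\end{bmatrix},\quad \widehat B_t=\begin{bmatrix}B_t\\0\end{bmatrix},\quad \widehat D_t=\begin{bmatrix}D_t\\0\end{bmatrix},\quad \widehat Q_t=\begin{bmatrix}Q_t&0\\0&0\end{bmatrix},$$ with sizes $(m+1)\times(m+1)$, $(m+1)\times n$, $(m+1)\times k$, $(m+1)\times(m+1)$. The augmented state is $\widehat x_t=(x_t^\top,1)^\top$. A policy is $\widehat K=(\widehat K_0,\dots,\widehat K_{T-1})$ with $\widehat K_t\in\mathbb R^{n\times(m+1)}$; it generates $u_t=-\widehat K_t\widehat x_t$ and $\widehat x_{t+1}=\widehat A_t\widehat x_t+\widehat B_tu_t+\widehat D_tw_t$. The initial state $x_0\sim\mathcal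 D$ has $\mathbb E[\widehat x_0\widehat x_0^\top]$ positive definite. The noises $w_0,\dots,w_{T-1}\in\mathbb R^k$ are i.i.d. and independent of $x_0$, with mean $\bar w_t=\mathbb E[w_t]$ and second moment $\Sigma_t^w=\mathbb E[w_tw_t^\top]\succ0$ (in the paper, the moments under the empirical measure of observed samples, treated as fixed constants). The cost is $C(\widehat K)=\mathbb E\left[\sum_{t=0}^{T-1}(\widehat x_t^\top\widehat Q_t\widehat x_t+u_t^\top R_tu_t)+\widehat x_T^\top\widehat Q_T\widehat x_T\right]$, and $\nabla_tC(\widehat K)=\partial C(\widehat K)/\partial\widehat K_t\in\mathbb R^{n\times(m+1)}$. Along the trajectory of $\widehat K$, $\mu_t=\mathbb E[\widehat x_t^\top]\in\mathbb R^{1\times(m+1)}$ and $\Sigma_t=\mathbb E[\widehat x_t\widehat x_t^\top]$. The matrices $\widehat P_t$ and vectors $\widehat r_t$ (depending on $\widehat K$) solve the backward recursions, for $t=T-1,\dots,0$, $$\widehat P_t=\widehat Q_t+\widehat K_t^\top R_t\widehat K_t+(\widehat A_t-\widehat B_t\widehat K_t)^\top\widehat P_{t+1}(\widehat A_t-\widehat B_t\widehat K_t),$$ $$\widehat r_t=(\widehat A_t-\widehat B_t\widehat K_t)^\top\widehat r_{t+1}+(\widehat A_t-\widehat B_t\widehat K_t)^\top\widehat P_{t+1}\widehat D_t\bar w_t,$$ with $\widehat P_T=\widehat Q_T$ and $\widehat r_T=0$. *)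

(* Defs.v *)
From HB Require Import structures.
From mathcomp Require Export all_boot all_order all_algebra.
From mathcomp Require Export all_classical all_reals all_analysis.

Export Order.TTheory GRing.Theory Num.Theory.
Export numFieldNormedType.Exports.

Set Implicit Arguments.
Unset Strict Implicit.
Unset Printing Implicit Defensive.

Local Open Scope classical_set_scope.
Local Open Scope ring_scope.

Definition quad_form {R : realType} {p : nat} (M : 'M[R]_p) (v : 'cV[R]_p) : R :=
  (v^T *m M *m v) 0 0.

Definition posdef {R : realType} {p : nat} (M : 'M[R]_p) : Prop :=
  M^T = M /\ forall v : 'cV[R]_p, v != 0 -> 0 < quad_form M v.

(* The gradient of a scalar function of a matrix, laid out like the matrix:
   entry (i, j) is the partial derivative with respect to the entry (i, j). *)
Definition mx_gradient {R : realType} {p q : nat} (f : 'M[R]_(p, q) -> R)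
    (X : 'M[R]_(p, q)) : 'M[R]_(p, q) :=
  \matrix_(i < p, j < q) 'D_(delta_mx i j) f X.

Section RandomMatrices.
Context {d : measure_display} {Omega : measurableType d} {R : realType}.
Variable P : probability Omega R.

Definition mx_borel (p q : nat) : set (set 'M[R]_(p, q)) :=
  <<s @open 'M[R]_(p, q) >>.

Definition random_mx (p q : nat) (X : Omega -> 'M[R]_(p, q)) : Prop :=
  forall S, mx_borel S -> measurable (X @^-1` S).

Definition sigma_mx (p q : nat) (X : Omega -> 'M[R]_(p, q)) : set (set Omega) :=
  preimage_set_system setT X (@mx_borel p q).

Definition mx_integrable (p q : nat) (X : Omega -> 'M[R]_(p, q)) : Prop :=
  forall i j, P.-integrable setT (fun o => (X o i j)%:E).

Definition mx_expectation (p q : nat) (X : Omega -> 'M[R]_(p, q)) : 'M[R]_(p, q) :=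
  \matrix_(i < p, j < q) fine 'E_P[fun o => X o i j].

Definition identically_distributed (p q : nat) (X Y : Omega -> 'M[R]_(p, q)) : Prop :=
  forall S, mx_borel S -> P (X @^-1` S) = P (Y @^-1` S).

Definition independent (F G : set (set Omega)) : Prop :=
  forall S U, F S -> G U -> P (S `&` U) = (P S * P U)%E.

Definition mutually_independent (I : finType) (F : I -> set (set Omega)) : Prop :=
  forall (J : {set I}) (S : I -> set Omega), (forall i, i \in J -> F i (S i)) ->
    P (\bigcap_(i in [set` J]) S i) = (\prod_(i in J) P (S i))%E.

End RandomMatrices.

Section AugmentedMatrices.
Context {R : realType} {m : nat}.

Definition hatA (A : 'M[R]_m) : 'M[R]_(m + 1) := block_mx A 0 0 1%:M.

(* Serves for both hat B and hat D. *)
Definition hatBD {p : nat} (B : 'M[R]_(m, p)) : 'M[R]_(m + 1, p) := col_mx B 0.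

Definition hatQ (Q : 'M[R]_m) : 'M[R]_(m + 1) := block_mx Q 0 0 0.

Definition hatx (x : 'cV[R]_m) : 'cV[R]_(m + 1) := col_mx x 1%:M.

End AugmentedMatrices.

(* Time-indexed data are sequences over nat, of which only the values at
   times t < T (t <= T for Q) are used. *)
Section ControlProblem.
Context {d : measure_display} {Omega : measurableType d} {R : realType}.
Variable P : probability Omega R.
Variables (m n k T : nat).
Variables (A : nat -> 'M[R]_m) (B : nat -> 'M[R]_(m, n)) (D : nat -> 'M[R]_(m, k)).
Variables (Rc : nat -> 'M[R]_n) (Q : nat -> 'M[R]_m).
Variables (x0 : Omega -> 'cV[R]_m) (w : nat -> Omega -> 'cV[R]_k).

Definition control (K : nat -> 'M[R]_(n, m + 1)) (t : nat) (x : 'cV[R]_(m + 1)) :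
    'cV[R]_n :=
  - (K t *m x).

Fixpoint state (K : nat -> 'M[R]_(n, m + 1)) (t : nat) (o : Omega) :
    'cV[R]_(m + 1) :=
  if t is s.+1 then
    hatA (A s) *m state K s o + hatBD (B s) *m control K s (state K s o)
      + hatBD (D s) *m w s o
  else hatx (x0 o).

Definition path_cost (K : nat -> 'M[R]_(n, m + 1)) (o : Omega) : R :=
  \sum_(0 <= t < T) (quad_form (hatQ (Q t)) (state K t o)
                     + quad_form (Rc t) (control K t (state K t o)))
  + quad_form (hatQ (Q T)) (state K T o).

Definition cost (K : nat -> 'M[R]_(n, m + 1)) : R := fine 'E_P[path_cost K].

(* The cost as a function of the gain at time t, the other gains being fixed. *)
Definition cost_at (K : nat -> 'M[R]_(n, m + 1)) (t : nat) (X : 'M[R]_(n, m + 1)) : R :=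
  cost (fun s => if s == t then X else K s).

Definition state_mean (K : nat -> 'M[R]_(n, m + 1)) (t : nat) : 'rV[R]_(m + 1) :=
  mx_expectation P (fun o => (state K t o)^T).

Definition state_moment (K : nat -> 'M[R]_(n, m + 1)) (t : nat) : 'M[R]_(m + 1) :=
  mx_expectation P (fun o => state K t o *m (state K t o)^T).

Definition closed_loop (K : nat -> 'M[R]_(n, m + 1)) (t : nat) : 'M[R]_(m + 1) :=
  hatA (A t) - hatBD (B t) *m K t.

Definition solves_P (K : nat -> 'M[R]_(n, m + 1)) (Ph : nat -> 'M[R]_(m + 1)) : Prop :=
  Ph T = hatQ (Q T) /\
  forall t, (t < T)%N ->
    Ph t = hatQ (Q t) + (K t)^T *m Rc t *m K t
           + (closed_loop K t)^T *m Ph t.+1 *m closed_loop K t.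

Definition solves_r (K : nat -> 'M[R]_(n, m + 1)) (Ph : nat -> 'M[R]_(m + 1))
    (rh : nat -> 'cV[R]_(m + 1)) : Prop :=
  rh T = 0 /\
  forall t, (t < T)%N ->
    rh t = (closed_loop K t)^T *m rh t.+1
           + (closed_loop K t)^T *m Ph t.+1 *m hatBD (D t) *m mx_expectation P (w t).

End ControlProblem.

(* Main.v *)
From HB Require Import structures.
From mathcomp Require Import ring measurable_realfun.
Require Import Defs.

Set Implicit Arguments.
Unset Strict Implicit.
Unset Printing Implicit Defensive.

Local Open Scope classical_set_scope.
Local Open Scope ring_scope.

(** The cost is the expectation of a quadratic function of an affine stochastic
    recursion, so only the first two moments of the state matter.

    Write [L s] for the closed-loop matrix [hat A - hat B K] at time [s] and
    [G] for [hat D].  Then the state satisfies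
    [x (s + 1) = L s x s + G w s], and [x s] is an affine function of [x0] and of
    [w 0], ..., [w (s - 1)], hence is uncorrelated with [w s].  Therefore the mean
    [mu] and the second moment [S] of the state satisfy closed linear recursions
    ([state_mean_rec], [state_moment_rec]), and the cost is the sum of the traces
    [tr (M s S s)], where [M s] is [hat Q + K^T R K], plus the terminal trace
    [tr (hat Q S T)] ([costE]).  The problem is now deterministic.

    The recursions defining [Ph] and [rh] are the adjoints of those of [S] and
    [mu]: the cost from time [s] on equals [tr (Ph s S s) + 2 tr (rh s mu s)] up to
    terms that involve only the noise ([cost_to_go_step], [cost_from]).  When the
    gain [X] at the single time [t] varies, [S s] and [mu s] for [s <= t] do not
    move, and neither do [Ph s] and [rh s] for [s > t].  Pulling the value at time
    [t + 1] back to time [t] through the update by [X] thus exhibits the cost as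
    an explicit quadratic polynomial in [X],
    [tr (X^T N X S) - 2 tr (X^T Z) + c] ([cost_at_quadratic]), with
    [N = R + B^T P B] and [Z = B^T P A S + F mu].  As [N] and [S] are symmetric, its
    gradient is [2 (N X S - Z)] ([mx_gradient_quadratic]), which at [X = K t] is
    [2 E S - 2 F mu].

    The one probabilistic input is that independent square-integrable vectors are
    uncorrelated ([independent_uncorrelated]): the joint law of two independent
    variables is the product of their laws, and Fubini applies. *)

(** * Expectations of random matrices *)

Section MatrixExpectation.
Context {d : measure_display} {Omega : measurableType d} {R : realType}.
Variable P : probability Omega R.

Lemma fine_expectationE (f : Omega -> R) : fine 'E_P[f] = \int[P]_o f o.
Proof. by rewrite unlock. Qed.

Lemma mx_expectationE p q (X : Omega -> 'M[R]_(p, q)) i j :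
  mx_expectation P X i j = \int[P]_o X o i j.
Proof. by rewrite mxE fine_expectationE. Qed.

Lemma integrableD_EFin (f g : Omega -> R) :
  P.-integrable setT (EFin \o f) -> P.-integrable setT (EFin \o g) ->
  P.-integrable setT (EFin \o (fun o => f o + g o)).
Proof. by move=> If Ig; apply: (integrableD _ If Ig). Qed.

Lemma integrable_sum_EFin (I : Type) (s : seq I) (f : I -> Omega -> R) :
  (forall i, P.-integrable setT (EFin \o f i)) ->
  P.-integrable setT (EFin \o (fun o => \sum_(i <- s) f i o)).
Proof.
move=> If; rewrite (_ : _ \o _ = fun o => \sum_(i <- s) (f i o)%:E)%E.
  by apply: integrable_sum => // i _; exact: If.
by apply/funext => o; rewrite /= sumEFin.
Qed.

Lemma Rintegral_sum_EFin (I : Type) (s : seq I) (f : I -> Omega -> R) :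
  (forall i, P.-integrable setT (EFin \o f i)) ->
  \int[P]_o (\sum_(i <- s) f i o) = \sum_(i <- s) \int[P]_o f i o.
Proof.
move=> If; elim: s => [|i s IH].
  by under eq_Rintegral do rewrite big_nil; rewrite big_nil Rintegral_cst// mul0r.
under eq_Rintegral do rewrite big_cons.
by rewrite big_cons RintegralD// ?IH//; exact: integrable_sum_EFin.
Qed.

Lemma mxtrace_mul_sum p q (C : 'M[R]_(q, p)) (X : 'M[R]_(p, q)) :
  \tr (C *m X) = \sum_i \sum_j C i j * X j i.
Proof. by apply: eq_bigr => i _; rewrite mxE. Qed.

Lemma integrable_mxtrace p q (C : 'M[R]_(q, p)) (X : Omega -> 'M[R]_(p, q)) :
  mx_integrable P X -> P.-integrable setT (EFin \o (fun o => \tr (C *m X o))).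
Proof.
move=> IX; under eq_fun do rewrite mxtrace_mul_sum.
do 2! [apply: integrable_sum_EFin => ?].
by apply: (integrableZl _ _ (IX _ _)).
Qed.

(** Every scalar linear form of a matrix is a trace [tr (C X)], so this is
    the linearity of the matrix expectation in full generality. *)
Lemma Rintegral_mxtrace p q (C : 'M[R]_(q, p)) (X : Omega -> 'M[R]_(p, q)) :
  mx_integrable P X ->
  \int[P]_o \tr (C *m X o) = \tr (C *m mx_expectation P X).
Proof.
move=> IX; rewrite mxtrace_mul_sum; under eq_Rintegral do rewrite mxtrace_mul_sum.
have ICX i j : P.-integrable setT (EFin \o (fun o => C i j * X o j i)).
  by apply: (integrableZl _ _ (IX _ _)).
rewrite Rintegral_sum_EFin => [|i]; last exact: integrable_sum_EFin.
apply: eq_bigr => i _; rewrite Rintegral_sum_EFin//.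
apply: eq_bigr => j _; rewrite RintegralZl//; last exact: IX.
by rewrite mx_expectationE.
Qed.

(** Tracing against an elementary matrix reads off an entry; this turns every
    statement about entries of matrix products into one about traces. *)
Lemma mxtrace_delta p q (C : 'M[R]_(p, q)) i j : \tr (delta_mx j i *m C) = C i j.
Proof.
rewrite mxtrace_mul_sum (bigD1 j)//= (bigD1 i)//= !mxE !eqxx mul1r.
rewrite !big1 ?addr0// => [k /negPf kj|k /negPf ki].
  by rewrite big1// => l _; rewrite !mxE kj mul0r.
by rewrite mxE ki andbF mul0r.
Qed.

Lemma mulmx3_entry p q p' q' (A : 'M[R]_(p', p)) (X : 'M[R]_(p, q))
    (B : 'M[R]_(q, q')) i j :
  (A *m X *m B) i j = \tr (B *m delta_mx j i *m A *m X).
Proof. by rewrite -mxtrace_delta mulmxA mxtrace_mulC !mulmxA. Qed.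

Lemma mx_integrable_mul p q p' q' (A : 'M[R]_(p', p)) (B : 'M[R]_(q, q'))
    (X : Omega -> 'M[R]_(p, q)) :
  mx_integrable P X -> mx_integrable P (fun o => A *m X o *m B).
Proof.
move=> IX i j; have := integrable_mxtrace (B *m delta_mx j i *m A) IX.
by apply: eq_integrable => // o _; rewrite /= mulmx3_entry.
Qed.

Lemma mx_expectation_mul p q p' q' (A : 'M[R]_(p', p)) (B : 'M[R]_(q, q'))
    (X : Omega -> 'M[R]_(p, q)) :
  mx_integrable P X ->
  mx_expectation P (fun o => A *m X o *m B) = A *m mx_expectation P X *m B.
Proof.
move=> IX; apply/matrixP => i j; rewrite mx_expectationE mulmx3_entry.
under eq_Rintegral do rewrite mulmx3_entry.
exact: Rintegral_mxtrace.
Qed.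

Lemma mx_integrableD p q (X Y : Omega -> 'M[R]_(p, q)) :
  mx_integrable P X -> mx_integrable P Y -> mx_integrable P (fun o => X o + Y o).
Proof.
move=> IX IY i j; have := integrableD_EFin (IX i j) (IY i j).
by apply: eq_integrable => // o _; rewrite /= mxE.
Qed.

Lemma mx_expectationD p q (X Y : Omega -> 'M[R]_(p, q)) :
  mx_integrable P X -> mx_integrable P Y ->
  mx_expectation P (fun o => X o + Y o) = mx_expectation P X + mx_expectation P Y.
Proof.
move=> IX IY; apply/matrixP => i j; rewrite [RHS]mxE !mx_expectationE.
under eq_Rintegral do rewrite mxE.
by rewrite RintegralD//; [exact: IX|exact: IY].
Qed.

Lemma mx_integrable_tr p q (X : Omega -> 'M[R]_(p, q)) :
  mx_integrable P X -> mx_integrable P (fun o => (X o)^T).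
Proof. by move=> IX i j; under eq_fun do rewrite mxE; exact: IX. Qed.

Lemma mx_expectation_tr p q (X : Omega -> 'M[R]_(p, q)) :
  mx_expectation P (fun o => (X o)^T) = (mx_expectation P X)^T.
Proof.
apply/matrixP => i j; rewrite [RHS]mxE !mx_expectationE.
by under eq_Rintegral do rewrite mxE.
Qed.

Lemma mx_expectation_cst p q (C : 'M[R]_(p, q)) : mx_expectation P (fun=> C) = C.
Proof.
apply/matrixP => i j; rewrite mx_expectationE Rintegral_cst//.
by rewrite [X in fine X]probability_setT mulr1.
Qed.

Lemma eq_mx_expectation p q (X Y : Omega -> 'M[R]_(p, q)) :
  X =1 Y -> mx_expectation P X = mx_expectation P Y.
Proof. by move=> /funext ->. Qed.

Lemma mx_integrable_mull p q r (A : 'M[R]_(r, p)) (X : Omega -> 'M[R]_(p, q)) :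
  mx_integrable P X -> mx_integrable P (fun o => A *m X o).
Proof.
move=> IX; rewrite (_ : (fun o => _) = fun o => A *m X o *m 1%:M).
  exact: mx_integrable_mul.
by apply/funext => o; rewrite mulmx1.
Qed.

Lemma mx_expectation_mull p q r (A : 'M[R]_(r, p)) (X : Omega -> 'M[R]_(p, q)) :
  mx_integrable P X ->
  mx_expectation P (fun o => A *m X o) = A *m mx_expectation P X.
Proof.
move=> IX; rewrite -[RHS]mulmx1 -mx_expectation_mul//.
by apply: eq_mx_expectation => o; rewrite mulmx1.
Qed.

Definition square_integrable p (x : Omega -> 'cV[R]_p) : Prop :=
  forall i, (fun o => x o i 0) \in Lfun P 2%:E.

Lemma square_integrable_outer p q (x : Omega -> 'cV[R]_p) (y : Omega -> 'cV[R]_q) :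
  square_integrable x -> square_integrable y ->
  mx_integrable P (fun o => x o *m (y o)^T).
Proof.
move=> x2 y2 i j; under eq_fun do rewrite mxE big_ord1 mxE.
exact: (iffLR (Lfun1_integrable _ _) (Lfun2_mul_Lfun1 (x2 i) (y2 j))).
Qed.

Lemma square_integrable_integrable p (x : Omega -> 'cV[R]_p) :
  square_integrable x -> mx_integrable P x.
Proof.
move=> x2 i j; rewrite ord1.
apply: (iffLR (Lfun1_integrable _ _) (Lfun_subset12 _ (x2 i))).
by rewrite fin_num_measure.
Qed.

Lemma square_integrableD p (x y : Omega -> 'cV[R]_p) :
  square_integrable x -> square_integrable y ->
  square_integrable (fun o => x o + y o).
Proof.
move=> x2 y2 i; rewrite (_ : (fun o => _) = (fun o => x o i 0) \+ (fun o => y o i 0)).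
  by apply: rpredD; rewrite ?lee1n.
by apply/funext => o; rewrite mxE.
Qed.

Lemma square_integrable_mul p q (A : 'M[R]_(q, p)) (x : Omega -> 'cV[R]_p) :
  square_integrable x -> square_integrable (fun o => A *m x o).
Proof.
move=> x2 i; rewrite (_ : (fun o => _) = \sum_j (A i j \o* (fun o => x o j 0))).
  elim/big_ind: _ => [|f g f2 g2|j _]; first exact: (Lfun_cst P 0 2).
    by apply: rpredD; rewrite ?lee1n.
  by rewrite Lfun_scale// ler1n.
by apply/funext => o; rewrite mxE fct_sumE; apply: eq_bigr => j _; rewrite mulrC.
Qed.

Lemma square_integrable_cst p (c : 'cV[R]_p) : square_integrable (fun=> c).
Proof. by move=> i; exact: Lfun_cst. Qed.

End MatrixExpectation.

(** * Independence implies absence of correlation *)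

Section Independence.
Context {d : measure_display} {Omega : measurableType d} {R : realType}.
Variable P : probability Omega R.

(** The joint law of [(X, Y)] agrees with the product of the two laws on
    rectangles, hence everywhere; Fubini then splits the integral of [x * y]. *)
Lemma Rintegral_mul_independent (X Y : Omega -> R) :
  X \in Lfun P 1 -> Y \in Lfun P 1 -> X \* Y \in Lfun P 1 ->
  (forall S U, measurable S -> measurable U ->
     P (X @^-1` S `&` Y @^-1` U) = (P (X @^-1` S) * P (Y @^-1` U))%E) ->
  \int[P]_o (X o * Y o) = \int[P]_o X o * \int[P]_o Y o.
Proof.
move=> X1 Y1 XY1 indep.
have mX : measurable_fun setT X by move: X1 => /andP[/[!inE]].
have mY : measurable_fun setT Y by move: Y1 => /andP[/[!inE]].
pose X' : {mfun Omega >-> R} := HB.pack X (isMeasurableFun.Build _ _ _ _ X mX).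
pose Y' : {mfun Omega >-> R} := HB.pack Y (isMeasurableFun.Build _ _ _ _ Y mY).
have mXY : measurable_fun setT (fun o => (X o, Y o)) by exact/measurable_fun_pair.
pose XY' : {mfun Omega >-> (R * R)%type} :=
  HB.pack (fun o => (X o, Y o)) (isMeasurableFun.Build _ _ _ _ _ mXY).
have joint S : measurable S ->
    (distribution P X' \x distribution P Y')%E S = distribution P XY' S.
  move=> mS; exact: (@product_measure_unique _ _ _ _ _ (distribution P X')
    (distribution P Y') (distribution P XY') indep S mS).
pose f : R * R -> \bar R := fun z => (z.1 * z.2)%:E.
have mf : measurable_fun [set: (R * R)%type] f.
  apply/measurable_EFinP; apply: measurable_funM.
    exact: measurable_fst.
  exact: measurable_snd.
move/Lfun1_integrable: (XY1) => IXY.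
move/Lfun1_integrable: (X1) => IX; move/Lfun1_integrable: (Y1) => IY.
have If : (distribution P X' \x distribution P Y')%E.-integrable setT f.
  apply/integrableP; split => //.
  rewrite (eq_measure_integral (distribution P XY')) => [|S mS _]; last exact: joint.
  by case/integrableP: (integrable_pushforward mXY mf IXY measurableT).
rewrite /Rintegral.
have -> : (\int[P]_o (X o * Y o)%:E =
    \int[distribution P X']_x \int[distribution P Y']_y f (x, y))%E.
  apply: etrans (esym (@integral12_prod_meas1 _ _ _ _ _ (distribution P X')
    (distribution P Y') f If)).
  rewrite (eq_measure_integral (distribution P XY')) => [|S mS _]; last exact: joint.
  by rewrite (@integral_distribution _ _ _ _ _ P XY').
have EX : (\int[distribution P X']_x x%:E = \int[P]_o (X o)%:E)%E.
  by rewrite (@integral_distribution _ _ _ _ _ P X')//.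
have EY : (\int[distribution P Y']_x x%:E = \int[P]_o (Y o)%:E)%E.
  by rewrite (@integral_distribution _ _ _ _ _ P Y')//.
have IidY : (distribution P Y').-integrable setT (EFin : R -> \bar R).
  by apply: (@integrable_pushforward _ _ _ _ _ Y mY P setT).
have finX : (\int[P]_o (X o)%:E)%E \is a fin_num by exact: integrable_fin_num.
have finY : (\int[P]_o (Y o)%:E)%E \is a fin_num by exact: integrable_fin_num.
rewrite -fineM//; congr fine.
transitivity (\int[distribution P X']_x (x%:E * \int[P]_o (Y o)%:E))%E.
  by apply: eq_integral => x _; rewrite -EY /f -integralZl//.
rewrite -EX -(fineK finY) integralZr//.
by apply: (@integrable_pushforward _ _ _ _ _ X mX P setT).
Qed.

(** Coordinates are continuous, so their preimages of open rays are open. *)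
Lemma mx_borel_coord p q i j (S : set R) : measurable S ->
  @mx_borel R p q ((fun M : 'M[R]_(p, q) => M i j) @^-1` S).
Proof.
move=> mS.
pose f : g_sigma_algebraType (@open 'M[R]_(p, q)) -> R := fun M => (M : 'M[R]_(p, q)) i j.
suff /(_ measurableT S mS) : measurable_fun setT f by rewrite setTI.
apply: (measurability _ (RGenOInfty.measurableE R)) => _ [_ [a ->]] <-.
rewrite setTI; apply: sub_sigma_algebra.
by apply: open_comp; [move=> M _; exact: coord_continuous|exact: interval_open].
Qed.

Lemma random_mx_entry p q (X : Omega -> 'M[R]_(p, q)) i j :
  random_mx X -> measurable_fun setT (fun o => X o i j).
Proof. by move=> rX _ S mS; rewrite setTI; exact: (rX _ (mx_borel_coord i j mS)). Qed.

(** The diagonal entries of [x x^T] are the squares of the entries of [x]. *)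
Lemma random_square_integrable p (x : Omega -> 'cV[R]_p) :
  random_mx x -> mx_integrable P (fun o => x o *m (x o)^T) -> square_integrable P x.
Proof.
move=> rx Ix i; have := Ix i i; under eq_fun do rewrite mxE big_ord1 mxE.
have mx := random_mx_entry i 0 rx.
move=> /integrableP[_ fin]; rewrite inE; apply/andP; split; rewrite inE//=.
rewrite /finite_norm unlock /Lnorm poweR_lty//.
congr (_ < _)%E: fin; apply: eq_integral => o _ /=.
by rewrite normrM -expr2 powR_mulrn.
Qed.

Definition uncorrelated p q (x : Omega -> 'cV[R]_p) (y : Omega -> 'cV[R]_q) : Prop :=
  mx_expectation P (fun o => x o *m (y o)^T)
    = mx_expectation P x *m (mx_expectation P y)^T.

Lemma mutually_independent_pair (I : finType) (F : I -> set (set Omega)) i j :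
  mutually_independent P F -> i != j -> independent P (F i) (F j).
Proof.
move=> indep ij S U FS FU.
pose V l := if l == i then S else U.
have FV l : l \in [set i; j]%SET -> F l (V l).
  by rewrite !inE /V => /orP[]/eqP->; rewrite ?eqxx // eq_sym (negPf ij).
have := indep _ _ FV.
have -> : \bigcap_(l in [set` [set i; j]%SET]) V l = S `&` U.
  apply/seteqP; split => o /=.
    move=> SU; split; first by have := SU i; rewrite /V /= eqxx; apply; rewrite !inE eqxx.
    by have := SU j; rewrite /V /= eq_sym (negPf ij); apply; rewrite !inE eqxx orbT.
  by move=> [So Uo] l _; rewrite /V; case: ifP.
move=> ->; rewrite big_setU1 ?inE//= big_set1 /V eqxx.
by rewrite eq_sym (negPf ij).
Qed.

Lemma independent_uncorrelated p q
    (x : Omega -> 'cV[R]_p) (y : Omega -> 'cV[R]_q) :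
  square_integrable P x -> square_integrable P y ->
  independent P (sigma_mx x) (sigma_mx y) ->
  uncorrelated x y.
Proof.
move=> x2 y2 indep; apply/matrixP => i j.
rewrite mx_expectationE mxE big_ord1 [X in _ * X]mxE !mx_expectationE.
under eq_Rintegral do rewrite mxE big_ord1 mxE.
have PT : P setT \is a fin_num by rewrite fin_num_measure.
apply: Rintegral_mul_independent.
- exact: (Lfun_subset12 PT (x2 i)).
- exact: (Lfun_subset12 PT (y2 j)).
- exact: (Lfun2_mul_Lfun1 (x2 i) (y2 j)).
- move=> S U mS mU; apply: indep.
    by exists ((fun M : 'cV[R]_p => M i 0) @^-1` S); [exact: mx_borel_coord|rewrite setTI].
  by exists ((fun M : 'cV[R]_q => M j 0) @^-1` U); [exact: mx_borel_coord|rewrite setTI].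
Qed.

Lemma uncorrelated_mull p q r (A : 'M[R]_(r, p)) (x : Omega -> 'cV[R]_p)
    (y : Omega -> 'cV[R]_q) :
  square_integrable P x -> square_integrable P y ->
  uncorrelated x y -> uncorrelated (fun o => A *m x o) y.
Proof.
move=> x2 y2 xy; rewrite /uncorrelated.
under eq_mx_expectation do rewrite -mulmxA.
rewrite !mx_expectation_mull ?xy ?mulmxA//; last exact: square_integrable_outer.
exact: square_integrable_integrable.
Qed.

Lemma uncorrelatedD p q (x x' : Omega -> 'cV[R]_p) (y : Omega -> 'cV[R]_q) :
  square_integrable P x -> square_integrable P x' -> square_integrable P y ->
  uncorrelated x y -> uncorrelated x' y -> uncorrelated (fun o => x o + x' o) y.
Proof.
move=> x2 x'2 y2 xy x'y; rewrite /uncorrelated.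
under eq_mx_expectation do rewrite mulmxDl.
rewrite !mx_expectationD ?xy ?x'y ?mulmxDl//;
  by [exact: square_integrable_outer|exact: square_integrable_integrable].
Qed.

Lemma uncorrelated_cst p q (c : 'cV[R]_p) (y : Omega -> 'cV[R]_q) :
  square_integrable P y -> uncorrelated (fun=> c) y.
Proof.
move=> y2; rewrite /uncorrelated mx_expectation_mull; last first.
  exact/mx_integrable_tr/square_integrable_integrable.
by rewrite mx_expectation_tr mx_expectation_cst.
Qed.

(** The augmentation is an affine map, which carries properties of [x] over to
    [hatx x]. *)
Lemma hatxE m (x : 'cV[R]_m) : hatx x = col_mx 1%:M 0 *m x + col_mx 0 1%:M.
Proof. by rewrite mul_col_mx mul1mx mul0mx add_col_mx addr0 add0r. Qed.

Lemma square_integrable_of_hatx_moment m (x : Omega -> 'cV[R]_m) :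
  random_mx x -> mx_integrable P (fun o => hatx (x o) *m (hatx (x o))^T) ->
  square_integrable P x.
Proof.
move=> rx Ix; apply: random_square_integrable => //.
have := mx_integrable_mul (row_mx 1%:M 0) (col_mx 1%:M 0) Ix.
congr mx_integrable; apply/funext => o.
by rewrite /hatx mulmxA mul_row_col mul1mx mul0mx addr0 -mulmxA tr_col_mx
  mul_row_col mulmx1 mulmx0 addr0.
Qed.

Lemma square_integrable_hatx m (x : Omega -> 'cV[R]_m) :
  square_integrable P x -> square_integrable P (fun o => hatx (x o)).
Proof.
move=> x2; under [X in square_integrable _ X]eq_fun do rewrite hatxE.
apply: square_integrableD; last exact: square_integrable_cst.
exact: square_integrable_mul.
Qed.

Lemma uncorrelated_hatx m q (x : Omega -> 'cV[R]_m) (y : Omega -> 'cV[R]_q) :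
  square_integrable P x -> square_integrable P y ->
  uncorrelated x y -> uncorrelated (fun o => hatx (x o)) y.
Proof.
move=> x2 y2 xy; under [X in uncorrelated X _]eq_fun do rewrite hatxE.
apply: uncorrelatedD => //; [exact: square_integrable_mul|exact: square_integrable_cst|..].
  exact: uncorrelated_mull.
exact: uncorrelated_cst.
Qed.

Lemma mx_expectation_affine p q r (L : 'M[R]_(r, p)) (G : 'M[R]_(r, q))
    (x : Omega -> 'cV[R]_p) (y : Omega -> 'cV[R]_q) :
  square_integrable P x -> square_integrable P y ->
  mx_expectation P (fun o => L *m x o + G *m y o)
    = L *m mx_expectation P x + G *m mx_expectation P y.
Proof.
move=> /square_integrable_integrable Ix /square_integrable_integrable Iy.
by rewrite mx_expectationD ?mx_expectation_mull//; exact: mx_integrable_mull.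
Qed.

(** In [E[(L x + G y) (L x + G y)^T]] the absence of correlation factors the two
    cross terms through the means. *)
Lemma second_moment_affine p q r (L : 'M[R]_(r, p)) (G : 'M[R]_(r, q))
    (x : Omega -> 'cV[R]_p) (y : Omega -> 'cV[R]_q) :
  square_integrable P x -> square_integrable P y -> uncorrelated x y ->
  let mu := mx_expectation P x in let nu := mx_expectation P y in
  mx_expectation P (fun o => (L *m x o + G *m y o) *m (L *m x o + G *m y o)^T)
    = L *m mx_expectation P (fun o => x o *m (x o)^T) *m L^T
      + L *m (mu *m nu^T) *m G^T + G *m (nu *m mu^T) *m L^T
      + G *m mx_expectation P (fun o => y o *m (y o)^T) *m G^T.
Proof.
move=> x2 y2 xy mu nu.
have yx : mx_expectation P (fun o => y o *m (x o)^T) = nu *m mu^T.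
  rewrite -[LHS]trmxK -mx_expectation_tr.
  under eq_mx_expectation do rewrite trmx_mul trmxK.
  by rewrite xy trmx_mul trmxK.
have Ixx := square_integrable_outer x2 x2; have Ixy := square_integrable_outer x2 y2.
have Iyx := square_integrable_outer y2 x2; have Iyy := square_integrable_outer y2 y2.
rewrite -xy -yx -!mx_expectation_mul// -!mx_expectationD//;
  do ?[exact: mx_integrable_mul|apply: mx_integrableD].
apply: eq_mx_expectation => o.
by rewrite [in LHS]linearD /= !trmx_mul mulmxDl !mulmxDr !mulmxA addrA.
Qed.

End Independence.

(** * Gradient of a quadratic function of a matrix *)

Section QuadraticGradient.
Context {R : realType} {p q : nat}.

(** Differentiability is followed entry by entry, so that products of matrices
    of different sizes reduce to sums of products of scalar functions. *)
Definition entrywise_differentiable a b (F : 'M[R]_(p, q) -> 'M[R]_(a, b)) X0 : Prop :=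
  forall i j, differentiable (fun X => F X i j) X0.

Lemma entrywise_differentiable_mul a b c (F : 'M[R]_(p, q) -> 'M[R]_(a, b))
    (G : 'M[R]_(p, q) -> 'M[R]_(b, c)) X0 :
  entrywise_differentiable F X0 -> entrywise_differentiable G X0 ->
  entrywise_differentiable (fun X => F X *m G X) X0.
Proof.
move=> dF dG i j.
rewrite (_ : (fun X => _) = \sum_l ((fun X => F X i l) * (fun X => G X l j))).
  by apply: differentiable_sum => l; apply: differentiableM.
by apply/funext => X; rewrite mxE fct_sumE.
Qed.

Lemma entrywise_differentiable_cst a b (C : 'M[R]_(a, b)) X0 :
  entrywise_differentiable (fun=> C) X0.
Proof. by move=> i j; exact: differentiable_cst. Qed.

Lemma entrywise_differentiable_tr a b (F : 'M[R]_(p, q) -> 'M[R]_(a, b)) X0 :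
  entrywise_differentiable F X0 -> entrywise_differentiable (fun X => (F X)^T) X0.
Proof. by move=> dF i j; under eq_fun do rewrite mxE; exact: dF. Qed.

Lemma differentiable_mxtrace a (F : 'M[R]_(p, q) -> 'M[R]_a) X0 :
  entrywise_differentiable F X0 -> differentiable (fun X => \tr (F X)) X0.
Proof.
move=> dF; rewrite (_ : (fun X => _) = \sum_i (fun X => F X i i)).
  by apply: differentiable_sum.
by apply/funext => X; rewrite fct_sumE.
Qed.

Lemma derive_quadratic (V : normedModType R) (f : V -> R) (X v : V) (a b : R) :
  (forall h : R, f (h *: v + X) = f X + h * a + h ^+ 2 * b) -> 'D_v f X = a.
Proof.
move=> fE; rewrite /derive; apply: cvg_lim => //.
apply: (@cvg_trans _ ((fun h : R => a + h * b) @ 0^')).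
  apply: near_eq_cvg; near=> h.
  have h0 : h != 0 by near: h; exact: nbhs_dnbhs_neq.
  rewrite /= fE (_ : _ - f X = h * (a + h * b)); last by ring.
  by rewrite /GRing.scale /= mulKf.
have : (fun h : R => a + h * b) @ 0^' --> a + 0 * b.
  apply: cvg_within_filter; apply: cvgD; first exact: cvg_cst.
  by apply: cvgM; [exact: cvg_id|exact: cvg_cst].
by rewrite mul0r addr0.
Unshelve. all: by end_near.
Qed.

Definition quadratic (N : 'M[R]_p) (S : 'M[R]_q) (Z : 'M[R]_(p, q)) (X : 'M[R]_(p, q)) : R :=
  \tr (X^T *m N *m X *m S) - 2 * \tr (X^T *m Z).

Lemma differentiable_quadratic N S Z c X :
  differentiable (fun Y => quadratic N S Z Y + c) X.
Proof.
apply: differentiableD; last exact: differentiable_cst.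
have dX i j : differentiable (fun Y : 'M[R]_(p, q) => Y i j) X by exact: differentiable_coord.
have dXt : entrywise_differentiable (fun Y => Y^T) X by exact: entrywise_differentiable_tr.
have dC a b (C : 'M[R]_(a, b)) := entrywise_differentiable_cst C X.
apply: differentiableB; last apply: differentiableZ.
  by apply: differentiable_mxtrace; do !apply: entrywise_differentiable_mul.
by apply: differentiable_mxtrace; apply: entrywise_differentiable_mul.
Qed.

Lemma quadratic_line N S Z X V h : N^T = N -> S^T = S ->
  quadratic N S Z (h *: V + X)
    = quadratic N S Z X + h * \tr (V^T *m (2 *: (N *m X *m S - Z)))
      + h ^+ 2 * \tr (V^T *m N *m V *m S).
Proof.
move=> symN symS.
have cross : \tr (X^T *m N *m V *m S) = \tr (V^T *m N *m X *m S).
  rewrite -mxtrace_tr !trmx_mul trmxK symN symS mxtrace_mulC.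
  by rewrite !mulmxA.
rewrite /quadratic [(h *: V + X)^T]linearD /= [(h *: V)^T]linearZ /=.
rewrite !(mulmxDl, mulmxDr) -!(scalemxAl, scalemxAr) mulmxDr mulmxN.
rewrite !(mxtraceD, mxtraceZ, raddfN) /= !mulmxA cross.
ring.
Qed.

Lemma mx_gradient_quadratic N S Z c X : N^T = N -> S^T = S ->
  mx_gradient (fun Y => quadratic N S Z Y + c) X = 2 *: (N *m X *m S - Z).
Proof.
move=> symN symS; apply/matrixP => i j; rewrite mxE.
rewrite (@derive_quadratic _ _ _ _ (\tr ((delta_mx i j)^T *m (2 *: (N *m X *m S - Z))))
  (\tr ((delta_mx i j)^T *m N *m delta_mx i j *m S))); last first.
  by move=> h; rewrite quadratic_line//; ring.
by rewrite trmx_delta mxtrace_delta.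
Qed.

End QuadraticGradient.

(** * One step of the cost-to-go recursion *)

Section CostToGo.
Context {R : realType} {p k : nat}.

(** The maps carrying [(P', r')] to [(Pt, r)] are adjoint, for the trace pairing,
    to those carrying [(S, mu)] to [(S', mu')], up to the stage weight [M] and the
    noise terms that do not meet the state.  The gain enters only through [L]
    and [M]. *)
Lemma cost_to_go_step (M S S' Pt P' L : 'M[R]_p) (mu mu' : 'rV[R]_p) (r r' : 'cV[R]_p)
    (G : 'M[R]_(p, k)) (wbar : 'cV[R]_k) (W : 'M[R]_k) :
  P'^T = P' ->
  S' = L *m S *m L^T + L *m (wbar *m mu)^T *m G^T + G *m (wbar *m mu) *m L^T
       + G *m W *m G^T ->
  mu' = mu *m L^T + wbar^T *m G^T ->
  Pt = M + L^T *m P' *m L ->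
  r = L^T *m r' + L^T *m P' *m G *m wbar ->
  \tr (P' *m S') + 2 * \tr (r' *m mu') + \tr (M *m S) =
  \tr (Pt *m S) + 2 * \tr (r *m mu)
    + (\tr (P' *m (G *m W *m G^T)) + 2 * \tr (r' *m (wbar^T *m G^T))).
Proof.
move=> symP -> -> -> ->.
have cross : \tr (P' *m (L *m (wbar *m mu)^T *m G^T))
    = \tr (L^T *m P' *m G *m wbar *m mu).
  rewrite -mxtrace_tr !trmx_mul !trmxK symP mxtrace_mulC !mulmxA.
  by rewrite mxtrace_mulC !mulmxA.
have cross' : \tr (P' *m (G *m (wbar *m mu) *m L^T))
    = \tr (L^T *m P' *m G *m wbar *m mu).
  by rewrite mulmxA mxtrace_mulC !mulmxA.
have quad : \tr (P' *m (L *m S *m L^T)) = \tr (L^T *m P' *m L *m S).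
  by rewrite mulmxA mxtrace_mulC !mulmxA.
have lin : \tr (r' *m (mu *m L^T)) = \tr (L^T *m r' *m mu).
  by rewrite mulmxA mxtrace_mulC !mulmxA.
rewrite !mulmxDr !mulmxDl !linearD /= cross cross' quad lin.
ring.
Qed.

End CostToGo.

(** Seen as a function of the gain [X] alone, the cost-to-go [tr (Pt S) + 2 tr (r mu)]
    at a fixed state distribution is a quadratic polynomial: the symmetries of
    [P'] and [S] merge the two terms linear in [X]. *)
Lemma cost_to_go_gain (R : realType) p n k (A Qh P' S : 'M[R]_p) (B : 'M[R]_(p, n))
  (G : 'M[R]_(p, k)) (Rc : 'M[R]_n) (mu : 'rV[R]_p) (r' : 'cV[R]_p) (wbar : 'cV[R]_k) X :
  P'^T = P' -> S^T = S ->
  let L := A - B *m X in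
  \tr ((Qh + X^T *m Rc *m X + L^T *m P' *m L) *m S)
    + 2 * \tr ((L^T *m r' + L^T *m P' *m G *m wbar) *m mu)
  = quadratic (Rc + B^T *m P' *m B) S
      (B^T *m P' *m A *m S + (B^T *m P' *m G *m wbar + B^T *m r') *m mu) X
    + (\tr (Qh *m S) + \tr (A^T *m P' *m A *m S)
       + 2 * \tr ((A^T *m r' + A^T *m P' *m G *m wbar) *m mu)).
Proof.
move=> symP symS L.
have cross : \tr (A^T *m P' *m B *m X *m S) = \tr (X^T *m B^T *m P' *m A *m S).
  rewrite -mxtrace_tr !trmx_mul trmxK symP symS mxtrace_mulC.
  by rewrite !mulmxA.
rewrite /quadratic /L [(A - _)^T]linearB /= trmx_mul.
rewrite !(mulmxDl, mulmxDr, mulNmx, mulmxN, mulmxA) !(mxtraceD, raddfN) /= cross.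
ring.
Qed.

Lemma trmx_hatQ (R : realType) m (Q : 'M[R]_m) : Q^T = Q -> (hatQ Q)^T = hatQ Q.
Proof. by move=> symQ; rewrite /hatQ tr_block_mx !trmx0 symQ. Qed.

(** Backward induction: each step is a sum of congruences of symmetric matrices. *)
Lemma solves_P_sym (R : realType) m n T (A : nat -> 'M[R]_m) (B : nat -> 'M[R]_(m, n)) Rc Q K Ph :
  (forall t, (t < T)%N -> (Rc t)^T = Rc t) -> (forall t, (t <= T)%N -> (Q t)^T = Q t) ->
  solves_P T A B Rc Q K Ph -> forall t, (t <= T)%N -> (Ph t)^T = Ph t.
Proof.
move=> symR symQ [PT Prec] t /subnK; move: (T - t)%N => j.
elim: j t => [|j IH] t tE.
  by move: tE; rewrite add0n => ->; rewrite PT trmx_hatQ ?symQ.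
have tT : (t < T)%N by rewrite -tE addSn ltnS leq_addl.
have symPt1 : (Ph t.+1)^T = Ph t.+1 by apply: IH; rewrite addnS -addSn.
rewrite Prec//; move: (closed_loop A B K t) => L.
rewrite !linearD /= !trmx_mul !trmxK symPt1 trmx_hatQ ?symR ?symQ ?(ltnW tT)//.
by rewrite !mulmxA.
Qed.

Lemma quad_form_trace (R : realType) p (M : 'M[R]_p) (v : 'cV[R]_p) :
  quad_form M v = \tr (M *m (v *m v^T)).
Proof. by rewrite mulmxA mxtrace_mulC mulmxA /quad_form [RHS]big_ord1. Qed.

(** * Moments of the state and the cost *)

Section ControlProblem.
Context {d : measure_display} {Omega : measurableType d} {R : realType}.
Context (P : probability Omega R) (m n k T : nat).
Context (A : nat -> 'M[R]_m) (B : nat -> 'M[R]_(m, n)) (D : nat -> 'M[R]_(m, k)).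
Context (Rc : nat -> 'M[R]_n) (Q : nat -> 'M[R]_m).
Context (x0 : Omega -> 'cV[R]_m) (w : nat -> Omega -> 'cV[R]_k).
(* All that the moments of the state retain of independence. *)
Context (x0_2 : square_integrable P (fun o => hatx (x0 o)))
  (w_2 : forall t, (t < T)%N -> square_integrable P (w t))
  (x0_w : forall t, (t < T)%N -> uncorrelated P (fun o => hatx (x0 o)) (w t))
  (w_w : forall s t, (s < t)%N -> (t < T)%N -> uncorrelated P (w s) (w t)).

Local Notation L := (closed_loop A B).
Local Notation x := (state A B D x0 w).
Local Notation S := (state_moment P A B D x0 w).
Local Notation mu := (state_mean P A B D x0 w).
Local Notation wbar t := (mx_expectation P (w t)).

Lemma state_closed_loop K s o :
  x K s.+1 o = L K s *m x K s o + hatBD (D s) *m w s o.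
Proof. by rewrite /= /control mulmxN /closed_loop mulmxBl mulmxA. Qed.

Lemma eq_state K K' s :
  (forall j, (j < s)%N -> K j = K' j) -> x K s = x K' s.
Proof.
elim: s => [//|s IH] KK'; apply/funext => o; rewrite !state_closed_loop IH.
  by rewrite /closed_loop KK'.
by move=> j js; apply: KK'; exact: ltnW.
Qed.

Lemma square_integrable_state K s : (s <= T)%N -> square_integrable P (x K s).
Proof.
elim: s => [//|s IH] sT; have -> := funext (state_closed_loop K s).
by apply: square_integrableD; apply: square_integrable_mul; [exact/IH/ltnW|exact: w_2].
Qed.

(** The state at time [s] is built from [x0] and the noise before [s]. *)
Lemma uncorrelated_state K s t : (s <= t)%N -> (t < T)%N -> uncorrelated P (x K s) (w t).
Proof.
move=> + tT; elim: s => [_|s IH st]; first exact: x0_w.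
have sT : (s < T)%N := ltn_trans st tT.
have -> := funext (state_closed_loop K s).
have xs2 := square_integrable_state K (ltnW sT).
apply: uncorrelatedD; do ?exact: square_integrable_mul; do ?exact: w_2.
- by apply: square_integrable_mul; exact: w_2.
- by apply: uncorrelated_mull => //; [exact: w_2|exact/IH/ltnW].
- by apply: uncorrelated_mull; [exact: w_2|exact: w_2|exact: w_w].
Qed.

Lemma state_mean_tr K s : mu K s = (mx_expectation P (x K s))^T.
Proof. exact: mx_expectation_tr. Qed.

Lemma state_mean_rec K s : (s < T)%N ->
  mu K s.+1 = mu K s *m (L K s)^T + (wbar s)^T *m (hatBD (D s))^T.
Proof.
move=> sT; rewrite !state_mean_tr; have -> := funext (state_closed_loop K s).
rewrite mx_expectation_affine; [|exact/square_integrable_state/ltnW|exact: w_2].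
by rewrite linearD /= !trmx_mul.
Qed.

Lemma state_moment_rec K s : (s < T)%N ->
  S K s.+1 = L K s *m S K s *m (L K s)^T
    + L K s *m (wbar s *m mu K s)^T *m (hatBD (D s))^T
    + hatBD (D s) *m (wbar s *m mu K s) *m (L K s)^T
    + hatBD (D s) *m mx_expectation P (fun o => w s o *m (w s o)^T)
        *m (hatBD (D s))^T.
Proof.
move=> sT; rewrite /state_moment; have -> := funext (state_closed_loop K s).
rewrite second_moment_affine; last 3 first.
- exact/square_integrable_state/ltnW.
- exact: w_2.
- exact: uncorrelated_state.
by rewrite state_mean_tr trmx_mul trmxK.
Qed.

Lemma state_moment_sym K s : (S K s)^T = S K s.
Proof.
rewrite /state_moment -mx_expectation_tr; apply: eq_mx_expectation => o.
by rewrite trmx_mul trmxK.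
Qed.

Definition stage_weight K s : 'M[R]_(m + 1) :=
  hatQ (Q s) + (K s)^T *m Rc s *m K s.

Lemma stage_costE K s (v : 'cV[R]_(m + 1)) :
  quad_form (hatQ (Q s)) v + quad_form (Rc s) (control K s v)
    = \tr (stage_weight K s *m (v *m v^T)).
Proof.
rewrite mulmxDl linearD /= -!quad_form_trace; congr (_ + _).
by rewrite /quad_form /control [(- _)^T]raddfN mulmxN !mulNmx opprK /= trmx_mul !mulmxA.
Qed.

Lemma costE K :
  cost P T A B D Rc Q x0 w K
    = \sum_(0 <= s < T) \tr (stage_weight K s *m S K s) + \tr (hatQ (Q T) *m S K T).
Proof.
have IS s : (s <= T)%N -> mx_integrable P (fun o => x K s o *m (x K s o)^T).
  by move=> sT; apply: square_integrable_outer; exact: square_integrable_state.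
rewrite /cost fine_expectationE /path_cost.
under eq_Rintegral do rewrite big_mkord quad_form_trace.
rewrite RintegralD//; first 1 last.
- apply: integrable_sum_EFin => s; under eq_fun do rewrite stage_costE.
  exact/integrable_mxtrace/IS/ltnW.
- exact/integrable_mxtrace/IS.
rewrite Rintegral_mxtrace ?big_mkord; last exact: IS.
congr (_ + _); rewrite Rintegral_sum_EFin => [|s]; last first.
  under eq_fun do rewrite stage_costE.
  exact/integrable_mxtrace/IS/ltnW.
apply: eq_bigr => s _; under eq_Rintegral do rewrite stage_costE.
by rewrite Rintegral_mxtrace//; exact/IS/ltnW.
Qed.

Context (K : nat -> 'M[R]_(n, m + 1)).
Context (Ph : nat -> 'M[R]_(m + 1)) (rh : nat -> 'cV[R]_(m + 1)).
Context (hPh : solves_P T A B Rc Q K Ph) (hrh : solves_r P T A B D w K Ph rh)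
  (symPh : forall s, (s <= T)%N -> (Ph s)^T = Ph s).

(** What the noise at time [s] adds to the cost whatever the state: the terms
    left over in [cost_to_go_step]. *)
Definition noise_cost s : R :=
  \tr (Ph s.+1 *m (hatBD (D s) *m mx_expectation P (fun o => w s o *m (w s o)^T)
                     *m (hatBD (D s))^T))
  + 2 * \tr (rh s.+1 *m ((mx_expectation P (w s))^T *m (hatBD (D s))^T)).

(** The cost-to-go from time [s] under the policy defining [Ph] and [rh], without
    the noise terms, for the state distribution that [K'] produces. *)
Definition value (K' : nat -> 'M[R]_(n, m + 1)) s : R :=
  \tr (Ph s *m S K' s) + 2 * \tr (rh s *m mu K' s).

(** Here [K'] need not be the policy for which [Ph] and [rh] solve their recursions:
    only the stage at time [s] is pulled back, with the gain [K' s]. *)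
Lemma stage_value (K' : nat -> 'M[R]_(n, m + 1)) s : (s < T)%N ->
  value K' s.+1 + \tr (stage_weight K' s *m S K' s)
    = \tr ((stage_weight K' s
             + (L K' s)^T *m Ph s.+1 *m L K' s) *m S K' s)
      + 2 * \tr (((L K' s)^T *m rh s.+1
             + (L K' s)^T *m Ph s.+1 *m hatBD (D s)
                 *m mx_expectation P (w s)) *m mu K' s)
      + noise_cost s.
Proof.
move=> sT; exact: (cost_to_go_step (symPh sT) (state_moment_rec K' sT)
  (state_mean_rec K' sT) erefl erefl).
Qed.

(** From time [t] on the two policies act alike, but [K'] may enter time [t] with
    other moments; the accumulated noise does not depend on them. *)
Lemma cost_from (K' : nat -> 'M[R]_(n, m + 1)) t :
  (t <= T)%N -> (forall s, (t <= s)%N -> K' s = K s) ->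
  \sum_(t <= s < T) \tr (stage_weight K' s *m S K' s) + \tr (hatQ (Q T) *m S K' T)
    = value K' t + \sum_(t <= s < T) noise_cost s.
Proof.
move=> tT KK'.
have [PT Prec] := hPh; have [rT rrec] := hrh.
have VT : \tr (hatQ (Q T) *m S K' T) = value K' T.
  by rewrite /value PT rT mul0mx mxtrace0 mulr0 addr0.
have step s : (t <= s < T)%N -> \tr (stage_weight K' s *m S K' s)
    = noise_cost s - (value K' s.+1 - value K' s).
  move=> /andP[ts sT].
  have L' : L K' s = L K s by rewrite /closed_loop KK'.
  have M' : stage_weight K' s = stage_weight K s by rewrite /stage_weight KK'.
  have := stage_value K' sT.
  rewrite L' M' -(Prec s sT) -(rrec s sT) -/(value K' s) => /eqP.
  rewrite addrC -subr_eq => /eqP <-; ring.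
rewrite (eq_big_nat _ _ step) sumrB telescope_sumr// VT.
ring.
Qed.

(** Before [t] nothing depends on [X]; after [t] the cost is, up to noise, the value at
    time [t.+1], which one step of the recursion expresses at time [t]. *)
Lemma cost_at_quadratic t : (t < T)%N ->
  let Bt := hatBD (B t) in
  exists c, forall X, cost_at P T A B D Rc Q x0 w K t X =
    quadratic (Rc t + Bt^T *m Ph t.+1 *m Bt) (S K t)
      (Bt^T *m Ph t.+1 *m hatA (A t) *m S K t
       + (Bt^T *m Ph t.+1 *m hatBD (D t) *m mx_expectation P (w t)
          + Bt^T *m rh t.+1) *m mu K t) X + c.
Proof.
move=> tT Bt.
pose G := hatBD (D t); pose wbar := mx_expectation P (w t).
exists (\tr (hatQ (Q t) *m S K t) + \tr ((hatA (A t))^T *m Ph t.+1 *m hatA (A t) *m S K t)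
  + 2 * \tr (((hatA (A t))^T *m rh t.+1
              + (hatA (A t))^T *m Ph t.+1 *m G *m wbar) *m mu K t)
  + \sum_(0 <= s < t) \tr (stage_weight K s *m S K s)
  + noise_cost t + \sum_(t.+1 <= s < T) noise_cost s) => X.
rewrite /cost_at costE; set K' := (fun s : nat => if s == t then X else K s).
have Kt : K' t = X by rewrite /K' eqxx.
have KK' s : (s < t)%N -> K s = K' s by move=> st; rewrite /K' ltn_eqF.
have xE s : (s <= t)%N -> state A B D x0 w K' s = state A B D x0 w K s.
  by move=> st; apply/esym/eq_state => j js; exact/KK'/(leq_trans js).
have SE s : (s <= t)%N -> S K' s = S K s by move=> st; rewrite /state_moment xE.
have muE : mu K' t = mu K t by rewrite /state_mean xE.
rewrite (big_cat_nat _ (n := t)) ?(ltnW tT)//= (@big_ltn _ _ _ t)//.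
rewrite -[LHS]addrA -[X in _ + X = _]addrA.
(* The three parts of the cost: before [t], at [t], and from [t.+1] on. *)
rewrite cost_from//; last by move=> s ts; rewrite /K' gtn_eqF.
rewrite (@eq_big_nat _ _ _ 0 t _ (fun s => \tr (stage_weight K s *m S K s))); last first.
  by move=> s /= st; rewrite SE ?(ltnW st)// /stage_weight KK'.
have := stage_value K' tT.
rewrite muE SE// /closed_loop /stage_weight Kt.
have symS := state_moment_sym K t.
rewrite -/Bt -/G -/wbar (cost_to_go_gain _ _ _ _ _ _ _ _ _ (symPh tT) symS).
(* What remains is linear in these four numbers. *)
move: (quadratic _ _ _ X) (value K' t.+1) (noise_cost t) (\tr ((hatQ (Q t) + _) *m _)).
move=> q v nc tr_t /(canRL (addrK _)) ->.
ring.
Qed.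

End ControlProblem.

(** * The gradient *)

Theorem lemma3p2 (R : realType) (d : measure_display) (Omega : measurableType d)
  (P : probability Omega R) (m n k T : nat)
  (hm : (1 <= m)%N) (hn : (1 <= n)%N) (hk : (1 <= k)%N) (hT : (1 <= T)%N)
  (A : nat -> 'M[R]_m) (B : nat -> 'M[R]_(m, n)) (D : nat -> 'M[R]_(m, k))
  (Rc : nat -> 'M[R]_n) (Q : nat -> 'M[R]_m)
  (hRc : forall t, (t < T)%N -> posdef (Rc t))
  (hQ : forall t, (t <= T)%N -> posdef (Q t))
  (x0 : Omega -> 'cV[R]_m) (w : nat -> Omega -> 'cV[R]_k)
  (x0_random : random_mx x0)
  (w_random : forall t, (t < T)%N -> random_mx (w t))
  (x0_moment : mx_integrable P (fun o => hatx (x0 o) *m (hatx (x0 o))^T))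
  (x0_posdef : posdef (mx_expectation P (fun o => hatx (x0 o) *m (hatx (x0 o))^T)))
  (w_moment : forall t, (t < T)%N -> mx_integrable P (fun o => w t o *m (w t o)^T))
  (w_posdef : forall t, (t < T)%N ->
     posdef (mx_expectation P (fun o => w t o *m (w t o)^T)))
  (w_indep : mutually_independent P (fun t : 'I_T => sigma_mx (w t)))
  (w_ident : forall s t, (s < T)%N -> (t < T)%N ->
     identically_distributed P (w s) (w t))
  (x0_indep : independent P (sigma_mx x0)
     <<s \bigcup_(t in [set t | (t < T)%N]) sigma_mx (w t) >>)
  (K : nat -> 'M[R]_(n, m + 1))
  (Ph : nat -> 'M[R]_(m + 1)) (rh : nat -> 'cV[R]_(m + 1))
  (hPh : solves_P T A B Rc Q K Ph)
  (hrh : solves_r P T A B D w K Ph rh)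
  (t : nat) (ht : (t < T)%N) :
  let wbar := mx_expectation P (w t) in
  let Bt := hatBD (B t) in
  let E := (Rc t + Bt^T *m Ph t.+1 *m Bt) *m K t - Bt^T *m Ph t.+1 *m hatA (A t) in
  let F := Bt^T *m Ph t.+1 *m hatBD (D t) *m wbar + Bt^T *m rh t.+1 in
  let C := cost_at P T A B D Rc Q x0 w K t in
  differentiable C (K t) /\
  mx_gradient C (K t) =
    2 *: (E *m state_moment P A B D x0 w K t)
    - 2 *: (F *m state_mean P A B D x0 w K t).
Proof.
move=> wbar Bt E F C.
have symR s : (s < T)%N -> (Rc s)^T = Rc s by move=> /hRc[].
have symQ s : (s <= T)%N -> (Q s)^T = Q s by move=> /hQ[].
have symPh := solves_P_sym symR symQ hPh.
have x0_2 := square_integrable_of_hatx_moment x0_random x0_moment.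
have w_2 s (sT : (s < T)%N) := random_square_integrable (w_random s sT) (w_moment s sT).
have x0_w s : (s < T)%N -> uncorrelated P (fun o => hatx (x0 o)) (w s).
  move=> sT; apply: uncorrelated_hatx => //; first exact: w_2.
  apply: independent_uncorrelated => //; first exact: w_2.
  by move=> U V xU wV; apply: x0_indep => //; apply: sub_sigma_algebra; exists s.
have w_w s u : (s < u)%N -> (u < T)%N -> uncorrelated P (w s) (w u).
  move=> su uT; have sT := ltn_trans su uT.
  apply: independent_uncorrelated; [exact: w_2|exact: w_2|].
  by apply: (mutually_independent_pair w_indep (i := Ordinal sT) (j := Ordinal uT));
    rewrite -val_eqE /= ltn_eqF.
have [c CE] := cost_at_quadratic (square_integrable_hatx x0_2) w_2 x0_w w_w hPh hrh
  symPh ht.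
have -> : C = _ := funext CE.
split; first exact: differentiable_quadratic.
have symN : (Rc t + Bt^T *m Ph t.+1 *m Bt)^T = Rc t + Bt^T *m Ph t.+1 *m Bt.
  by rewrite linearD /= !trmx_mul trmxK symR// symPh// mulmxA.
rewrite mx_gradient_quadratic//; last exact: state_moment_sym.
by rewrite -scalerBr opprD addrA -mulmxBl.
Qed.
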